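(* Let $(a_n)_{n\geq 0}$ be a sequence of nonnegative real numbers such that $a_0=1$ and $a_{i+j}\leq a_ia_j$ for all integers $i,j\geq 0$. (i) Suppose $a_k=0$ for some $k>0$. If $x$ is an element of a Banach algebra with $\lVert x^n\rVert=a_n$ for all $n\geq 0$, then $\sigma(x)=\{0\}$. Furthermore, there exists an element $y$ in some Banach algebra such that $\lVert y^n\rVert=a_n$ for all $n\geq 0$. (ii) Suppose each $a_n$ is positive. For each $i\in\mathbb{Z}$ let $C_i=\sup\{a_{m+i}/a_m : m\geq 0,\ m+i\geq 0\}\in(0,\infty]$. Let $K$ be the annulus given by $$K=\begin{cases}\{\lambda\in\mathbb{C}:|\lambda|\leq\inf_{k>0}C_k^{1/k}\}, & \text{if } C_{-1}=\infty,\\ \{\lambda\in\mathbb{C}:\frac{1}{\inf_{k>0}C_{-k}^{1/k}}\leq|\lambda|\leq\inf_{k>0}C_k^{1/k}\}, & \text{if } C_{-1}\text{ is finite},\end{cases}$$ where the infima are over positive integers $k$. If $x$ is an element of a Banach algebra with $\lVert x^n\rVert=a_n$ for all $n\geq 0$, then the smallest annulus centered at the origin containing $\sigma(x)$ contains $K$. Furthermore, there exists an element $y$ in some Banach algebra such that $\lVert y^n\rVert=a_n$ for all $n\geq 0$ and $\sigma(y)=K$.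
   Context: Banach algebras are complex and unital, with submultiplicative norm and $\lVert 1\rVert=1$. $\sigma(x)=\{\lambda\in\mathbb{C}:\lambda\cdot 1-x\text{ is not invertible}\}$ is the spectrum of $x$, a nonempty compact set. A (closed) annulus centered at the origin is a set $\{\lambda\in\mathbb{C}: r\le|\lambda|\le R\}$ with $0\le r\le R<\infty$; in particular closed discs centered at the origin (inner radius $0$) and circles centered at the origin count as annuli. The smallest annulus centered at the origin containing $\sigma(x)$ is thus the one with $r=\min_{\lambda\in\sigma(x)}|\lambda|$ and $R=\max_{\lambda\in\sigma(x)}|\lambda|$. *)

(* Defs.v *)
From HB Require Import structures.
From mathcomp Require Import all_boot all_order all_algebra.
From mathcomp Require Import complex.
From mathcomp Require Import all_classical all_reals all_analysis.

Set Implicit Arguments.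
Unset Strict Implicit.
Unset Printing Implicit Defensive.

Import Order.TTheory GRing.Theory Num.Theory.
Import numFieldNormedType.Exports.

Local Open Scope classical_set_scope.
Local Open Scope ring_scope.
Local Open Scope complex_scope.

(* HB rejects a direct join of CompleteNormedModule and GRing.Algebra: its
   part joining PzSemiRing and SemiNormedZmodule would have to be declared
   before Num.NumDomain. Hence the product is a field of the mixin and the
   algType structure is derived from it, over the same zmodule and scaling. *)
HB.mixin Record CompleteNormedModule_isBanachAlgebra (K : numFieldType) A
    & CompleteNormedModule K A := {
  bone : A ;
  bmul : A -> A -> A ;
  bmulA : associative bmul ;
  bmul1l : left_id bone bmul ;
  bmul1r : right_id bone bmul ;
  bmulDl : left_distributive bmul +%R ;
  bmulDr : right_distributive bmul +%R ;
  bscaleAl : forall (c : K) (x y : A), c *: bmul x y = bmul (c *: x) y ;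
  bscaleAr : forall (c : K) (x y : A), c *: bmul x y = bmul x (c *: y) ;
  bnorm1 : `|bone| = 1 ;
  bnormM : forall x y : A, `|bmul x y| <= `|x| * `|y|
}.

#[short(type="banachAlgType")]
HB.structure Definition BanachAlgebra (K : numFieldType) :=
  {A of CompleteNormedModule K A & CompleteNormedModule_isBanachAlgebra K A}.

Section BanachAlgebraAlgType.
Variables (K : numFieldType) (A : banachAlgType K).

Lemma bone_neq0 : bone != 0 :> A.
Proof. by rewrite -normr_eq0 bnorm1 oner_neq0. Qed.

#[non_forgetful_inheritance]
HB.instance Definition _ := GRing.Zmodule_isNzRing.Build A
  bmulA bmul1l bmul1r bmulDl bmulDr bone_neq0.
#[non_forgetful_inheritance]
HB.instance Definition _ := GRing.Lmodule_isLalgebra.Build K A bscaleAl.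
#[non_forgetful_inheritance]
HB.instance Definition _ := GRing.Lalgebra_isAlgebra.Build K A bscaleAr.

End BanachAlgebraAlgType.

(* GRing.unit needs a unitRingType, which would make an inversion function
   part of the data of the algebra. *)
Definition invertible (A : nzRingType) (x : A) : Prop :=
  exists y : A, y * x = 1 /\ x * y = 1.

Definition spectrum (R : realType) (A : banachAlgType R[i]) (x : A) :
    set R[i] :=
  [set lam | ~ invertible (lam%:A - x)].

(* The norm of R[i] takes its values in R[i]; `|z| = (modulus z)%:C. *)
Definition modulus (R : realType) (z : R[i]) : R := complex.Re `|z|.

Definition annulus (R : realType) (r1 r2 : R) : set R[i] :=
  [set lam | r1 <= modulus lam <= r2].

Definition is_annulus (R : realType) (B : set R[i]) : Prop :=
  exists r1 r2 : R, [/\ 0 <= r1, r1 <= r2 & B = annulus r1 r2].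

Definition smallest_annulus (R : realType) (S B : set R[i]) : Prop :=
  [/\ is_annulus B, S `<=` B &
      forall B', is_annulus B' -> S `<=` B' -> B `<=` B'].

Local Open Scope ereal_scope.

(* The pairs (m, n) with n = m + i in int are those with m >= 0, m + i >= 0. *)
Definition C_ (R : realType) (a : nat -> R) (i : int) : \bar R :=
  ereal_sup [set e | exists m n : nat,
    n%:Z = (m%:Z + i)%R /\ e = (a n / a m)%:E].

Definition inf_root (R : realType) (u : nat -> \bar R) : \bar R :=
  ereal_inf [set u k `^ (k%:R^-1)%R | k in [set k : nat | (0 < k)%N]].

Definition K_ (R : realType) (a : nat -> R) : set R[i] :=
  if C_ a (-1)%R == +oo then
    [set lam | (modulus lam)%:E <= inf_root (fun k => C_ a k%:Z)]
  else
    [set lam | (inf_root (fun k => C_ a (- k%:Z)%R))^-1 <= (modulus lam)%:E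
               <= inf_root (fun k => C_ a k%:Z)].

(* Main.v *)
Require Import Defs.
From HB Require Import structures.
From mathcomp Require Import all_boot all_order all_algebra.
From mathcomp Require Import complex.
From mathcomp Require Import all_classical all_reals all_analysis.
From mathcomp Require Import ring lra zify.

Set Implicit Arguments.
Unset Strict Implicit.
Unset Printing Implicit Defensive.

Import Order.TTheory GRing.Theory Num.Theory.
Import numFieldNormedType.Exports.

Local Open Scope classical_set_scope.
Local Open Scope ring_scope.
Local Open Scope complex_scope.

(** Let nu = inf_(k > 0) a_k^(1/k) and let x be an element whose powers have
    the norms a_n.

    Everything about spectra rests on the spectral radius formula, which is
    obtained here without complex analysis. Its easy half,
    [spectrum_modulus], is the Neumann series. Its hard half, [spectrum_ge],
    says that a number t with t^k <= |x^k| for all k is at most the modulus of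
    some point of the spectrum. The proof, due to Rickart, replaces
    Cauchy's formula by the finite identity
      (1 - y^n)^-1 = 1/n sum_(j < n) (1 - w^j y)^-1,  w = exp (2 i pi / n).
    If nu > 0 and y = x / nu had 1 - z y invertible for all |z| <= 1, the
    resolvent would be bounded on the unit circle, so that replacing y by s y
    with s < 1 close to 1 would change the right-hand side little, uniformly
    in n. But
    (s y)^n tends to 0 along a subsequence, so (1 - y^n)^-1 would come close
    to 1, and some y^n would have norm < 1, contrary to the choice of nu.

    For the containment of K in the smallest annulus: the numbers C_k with
    k >= 0 are the a_k, so the outer radius of K is nu and [spectrum_ge] gives
    a point of the spectrum at least that far out. If 0 is in the spectrum, the
    inner radius is no constraint. Otherwise x is invertible and
    C_(-k) <= |x^(-k)|, so that C_(-1) is finite, and [spectrum_ge] applied to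
    x^-1 bounds the inner radius. When some a_k vanishes, x is
    nilpotent and the two halves of the formula leave only 0.

    The algebras that realize the sequence consist of the bounded operators on
    a weighted supremum-norm space of families phi : T -> C, |phi_t| <= M w_t,
    and y is the shift phi |-> phi o s. Its powers attain their norms at the
    weight w itself, and the families lam^t that lie in the space are
    eigenvectors, which fill the spectrum ([shift_norm], [shift_eigen]).
    With T the natural numbers and w = a, the norms of the powers are a_k (zero
    weights included) and the spectrum is the disc of radius nu; this
    settles the first part and the case C_(-1) infinite. When
    C_(-1) is finite, C is a submultiplicative weight on the integers, the
    bilateral shift is invertible with norms of powers C_k for all k in Z, and
    its spectrum is the annulus. *)

(** * Norms with real values *)

Section RealNorm.
Variable R : realType.

(** The norm of a complex normed module is a complex number; real arithmetic
    and suprema call for the same number as an element of R. *)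
Definition nrm (V : normedZmodType R[i]) (v : V) : R := complex.Re `|v|.

Section Zmod.
Variable V : normedZmodType R[i].
Implicit Types u v : V.

Lemma nrmE v : `|v| = (nrm v)%:C.
Proof. by rewrite /nrm RRe_real// ger0_real. Qed.

Lemma nrm_ge0 v : 0 <= nrm v.
Proof. by rewrite -lecR -nrmE normr_ge0. Qed.

Lemma nrm0 : nrm (0 : V) = 0.
Proof. by apply: complexI; rewrite -nrmE normr0. Qed.

Lemma nrm_eq0 v : (nrm v == 0) = (v == 0).
Proof. by rewrite -(inj_eq (@complexI R)) -nrmE normr_eq0. Qed.

Lemma nrmN v : nrm (- v) = nrm v.
Proof. by rewrite /nrm normrN. Qed.

Lemma nrm_distC u v : nrm (u - v) = nrm (v - u).
Proof. by rewrite /nrm distrC. Qed.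

Lemma nrmD u v : nrm (u + v) <= nrm u + nrm v.
Proof. by rewrite -lecR rmorphD/= -!nrmE ler_normD. Qed.

Lemma nrmB u v : nrm (u - v) <= nrm u + nrm v.
Proof. by rewrite -(nrmN v) nrmD. Qed.

Lemma nrm_sum (I : Type) (r : seq I) (P : pred I) (F : I -> V) :
  nrm (\sum_(i <- r | P i) F i) <= \sum_(i <- r | P i) nrm (F i).
Proof.
elim/big_ind2 : _ => //; first by rewrite nrm0.
by move=> x1 x2 y1 y2 h1 h2; rewrite (le_trans (nrmD _ _))// lerD.
Qed.

Lemma nrm_le_eps v : (forall e : R, 0 < e -> nrm v <= e) -> v = 0.
Proof.
move=> h; apply/eqP; rewrite -nrm_eq0 eq_le nrm_ge0 andbT.
by apply/ler_addgt0Pl => e e0; rewrite addr0 h.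
Qed.

End Zmod.

Lemma modulusE (z : R[i]) : modulus z = nrm z. Proof. by []. Qed.

Lemma modulus_ge0 (z : R[i]) : 0 <= modulus z.
Proof. by rewrite modulusE nrm_ge0. Qed.

Lemma modulus_gt0 (z : R[i]) : (0 < modulus z) = (z != 0).
Proof. by rewrite lt_neqAle modulus_ge0 andbT eq_sym modulusE nrm_eq0. Qed.

Lemma modulus0 : modulus (0 : R[i]) = 0.
Proof. by rewrite /modulus normr0. Qed.

Lemma modulusM (x y : R[i]) : modulus (x * y) = modulus x * modulus y.
Proof. by apply: complexI; rewrite rmorphM/= !modulusE -!nrmE normrM. Qed.

Lemma modulus1 : modulus (1 : R[i]) = 1.
Proof. by apply: complexI; rewrite modulusE -nrmE normr1. Qed.

Lemma modulusX (x : R[i]) n : modulus (x ^+ n) = modulus x ^+ n.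
Proof. by elim: n => [|n ih]; rewrite ?modulus1// !exprS modulusM ih. Qed.

Lemma modulusV (x : R[i]) : modulus x^-1 = (modulus x)^-1.
Proof. by apply: complexI; rewrite fmorphV/= !modulusE -!nrmE normfV. Qed.

Lemma modulus_real (x : R) : modulus x%:C = `|x|.
Proof. by rewrite /modulus normc_def/= expr0n/= addr0 sqrtr_sqr. Qed.

Lemma nrmZ (V : normedModType R[i]) (c : R[i]) (v : V) :
  nrm (c *: v) = modulus c * nrm v.
Proof. by apply: complexI; rewrite rmorphM/= modulusE -!nrmE normrZ. Qed.

Section Convergence.
Variable V : normedModType R[i].

Lemma cvg_nrmP (F : set_system V) {FF : Filter F} (l : V) :
  F --> l <-> forall e : R, 0 < e -> \forall y \near F, nrm (l - y) < e.
Proof.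
split=> [/cvgrPdist_lt Fl e e0|h].
  have := Fl e%:C; rewrite ltcR => /(_ e0).
  by apply: filterS => y; rewrite nrmE ltcR.
apply/cvgrPdist_lt => e e0.
have eE : e = (complex.Re e)%:C by rewrite RRe_real// gtr0_real.
have := h (complex.Re e); rewrite -ltcR -eE => /(_ e0).
by apply: filterS => y; rewrite -ltcR -nrmE -eE.
Qed.

Lemma cauchy_nrm (F : set_system V) {FF : ProperFilter F} : cauchy F ->
  forall e : R, 0 < e -> exists x, \forall y \near F, nrm (x - y) < e.
Proof.
move=> /cauchyP Fc e e0.
have [|x Fx] := Fc e%:C; first by rewrite ltcR.
exists x; near=> y; rewrite -ltcR -nrmE.
near: y; apply: filterS Fx => y; by rewrite -ball_normE.
Unshelve. all: by end_near. Qed.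

Lemma cauchy_nrmP (F : set_system V) {FF : ProperFilter F} :
  (forall e : R, 0 < e -> exists x, \forall y \near F, nrm (x - y) < e) ->
  cauchy F.
Proof.
move=> h; apply/cauchyP => e e0.
have eE : e = (complex.Re e)%:C by rewrite RRe_real// gtr0_real.
have [|x Fx] := h (complex.Re e); first by rewrite -ltcR -eE.
exists x; apply: filterS Fx => y.
by rewrite -ball_normE /= -ltcR -nrmE -eE.
Qed.
End Convergence.

End RealNorm.

(** A separate name for C as a normed module over itself, so that its
    completeness is kept apart from that of the reals over themselves. *)
Definition cplx (R : realType) : Type := R[i].
HB.instance Definition _ (R : realType) := NormedModule.copy (cplx R) (R[i]^o).

Section Cplx.
Variable R : realType.

Lemma modulus_Re (z : R[i]) : `|complex.Re z| <= modulus z.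
Proof.
rewrite /modulus normc_def/= -sqrtr_sqr ler_sqrt ?lerDl ?sqr_ge0//.
by rewrite addr_ge0 ?sqr_ge0.
Qed.

Lemma modulus_Im (z : R[i]) : `|complex.Im z| <= modulus z.
Proof.
rewrite /modulus normc_def/= -sqrtr_sqr ler_sqrt ?lerDr ?sqr_ge0//.
by rewrite addr_ge0 ?sqr_ge0.
Qed.

Lemma modulus_le (z : R[i]) : modulus z <= `|complex.Re z| + `|complex.Im z|.
Proof.
rewrite /modulus normc_def/= -[leRHS]ger0_norm ?addr_ge0//.
rewrite -sqrtr_sqr ler_sqrt ?sqr_ge0// sqrrD !real_normK ?num_real//.
have : 0 <= `|complex.Re z| * `|complex.Im z| by rewrite mulr_ge0.
lra.
Qed.

(** The real and imaginary parts are 1-Lipschitz for the modulus, so they map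
    a Cauchy filter to Cauchy filters of reals; their limits are those of the
    filter because the modulus is at most the sum of the two parts. *)
Lemma cplx_complete (F : set_system (cplx R)) :
  ProperFilter F -> cauchy F -> cvg F.
Proof.
move=> FF Fc.
have key (p : cplx R -> R) : (forall x y, p (x - y) = p x - p y) ->
    (forall x, `|p x| <= nrm x) -> cvg (p @ F).
  move=> pB ple; apply/cauchy_cvgP/cauchyP => e e0.
  have [x Fx] := cauchy_nrm Fc e0.
  exists (p x); rewrite /= near_simpl; apply: filterS Fx => y xy.
  by rewrite -ball_normE/= -pB (le_lt_trans (ple _)).
have ReB (x y : R[i]) : complex.Re (x - y) = complex.Re x - complex.Re y.
  by case: x y => [? ?] [].
have ImB (x y : R[i]) : complex.Im (x - y) = complex.Im x - complex.Im y.
  by case: x y => [? ?] [].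
have /cvg_ex[/= a Fa] : cvg (@complex.Re R @ F).
  by apply: key; [exact: ReB|exact: modulus_Re].
have /cvg_ex[/= b Fb] : cvg (@complex.Im R @ F).
  by apply: key; [exact: ImB|exact: modulus_Im].
apply/cvg_ex; exists (a +i* b : cplx R); apply/cvg_nrmP => e e0.
near=> z; rewrite (le_lt_trans (modulus_le _))//.
rewrite ReB ImB/=.
rewrite [e]splitr ltrD//.
  near: z; move/cvgrPdist_lt : Fa; apply; exact: divr_gt0.
near: z; move/cvgrPdist_lt : Fb; apply; exact: divr_gt0.
Unshelve. all: by end_near. Qed.

HB.instance Definition _ := Uniform_isComplete.Build (cplx R) cplx_complete.
End Cplx.

(** * Invertibility in Banach algebras *)

Lemma expr_small (R : realType) (q e : R) : 0 <= q < 1 -> 0 < e ->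
  exists N, forall n, (N <= n)%N -> q ^+ n < e.
Proof.
move=> /andP[q0 q1] e0; have : `|q| < 1 by rewrite ger0_norm.
move=> /cvg_expr /cvgrPdist_lt /(_ e e0) [N _ h]; exists N => n /h /=.
by rewrite sub0r normrN ger0_norm ?exprn_ge0.
Qed.

Section Invertible.
Variable A : nzRingType.
Implicit Types x y : A.

Lemma inverse_unique x y z : y * x = 1 -> x * z = 1 -> y = z.
Proof. by move=> yx xz; rewrite -[y]mulr1 -xz mulrA yx mul1r. Qed.

Lemma invertibleM x y : invertible x -> invertible y -> invertible (x * y).
Proof.
move=> [x' [x'x xx']] [y' [y'y yy']]; exists (y' * x').
by rewrite mulrA -(mulrA y') x'x mulr1 y'y -mulrA (mulrA y) yy' mul1r xx'.
Qed.

(** An inverse of x * y makes x left and right invertible, since the two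
    factors commute; the two one-sided inverses then agree. *)
Lemma invertible_comm x y : x * y = y * x -> invertible (x * y) ->
  invertible x.
Proof.
move=> xy [z [zxy xyz]]; exists (z * y); split.
  by rewrite -mulrA -xy.
rewrite (@inverse_unique x (z * y) (y * z)) ?mulrA//.
by rewrite -mulrA -xy.
Qed.

(** 1 - y divides 1 - y^k, and the quotient, a polynomial in y, commutes
    with it. *)
Lemma invertible_geometric y k : invertible (1 - y ^+ k) -> invertible (1 - y).
Proof.
have E : 1 - y ^+ k = (1 - y) * (\sum_(i < k) y ^+ i).
  by rewrite -opprB subrX1 -mulNr opprB.
rewrite E; apply: invertible_comm.
apply/commr_sum => i _; apply: commrX.
by apply: commr_sym; apply: commrB => //; exact: commr1.
Qed.

End Invertible.

Section BanachAlgebra.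
Variables (R : realType) (A : banachAlgType R[i]).
Implicit Types x y z : A.

Lemma nrm1 : nrm (1 : A) = 1.
Proof. by apply: complexI; rewrite -nrmE; exact: bnorm1. Qed.

Lemma nrmM x y : nrm (x * y) <= nrm x * nrm y.
Proof. by rewrite -lecR rmorphM/= -!nrmE; exact: bnormM. Qed.

Lemma nrmX x n : nrm (x ^+ n) <= nrm x ^+ n.
Proof.
elim: n => [|n ih]; first by rewrite !expr0 nrm1.
by rewrite !exprS (le_trans (nrmM _ _))// ler_wpM2l// nrm_ge0.
Qed.

Lemma scale_invertible (c : R[i]) x : c != 0 -> invertible x ->
  invertible (c *: x).
Proof.
move=> c0 [y [yx xy]]; exists (c^-1 *: y).
by rewrite -!scalerAl -!scalerAr !scalerA yx xy mulVf// mulfV// !scale1r.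
Qed.

(** Multiplication by 1 - y shrinks norms at most by the factor 1 - |y|, and it
    sends the partial sums of the geometric series to 1 - y^n. Hence these sums
    form a Cauchy sequence, whose limit inverts 1 - y. *)
Lemma neumann y : nrm y < 1 -> invertible (1 - y).
Proof.
move=> y1; set q := nrm y in y1 *.
have q0 : 0 <= q := nrm_ge0 y.
pose S n := \sum_(i < n) y ^+ i.
have SE n : (1 - y) * S n = 1 - y ^+ n.
  by rewrite -opprB mulNr -subrX1 opprB.
have SC n : S n * (1 - y) = (1 - y) * S n.
  apply: commr_sym; apply: commr_sum => i _; apply: commrX.
  by apply: commr_sym; apply: commrB => //; exact: commr1.
have lb z : (1 - q) * nrm z <= nrm ((1 - y) * z).
  rewrite mulrBl mul1r mulrBl mul1r lerBlDr.
  have {1}-> : z = (z - y * z) + y * z by rewrite subrK.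
  by rewrite (le_trans (nrmD _ _))// lerD2l nrmM.
have Sc : cauchy (S @ \oo).
  apply: cauchy_nrmP => e e0.
  have [| |N HN] := @expr_small _ q ((1 - q) * (e / 2)).
  - by rewrite q0.
  - by rewrite mulr_gt0 ?divr_gt0// subr_gt0.
  exists (S N); exists N => // n /= Nn.
  (* (1 - y) (S N - S n) = y^n - y^N, both terms being small *)
  have : (1 - q) * nrm (S N - S n) < (1 - q) * e.
    rewrite (le_lt_trans (lb _))// mulrBr !SE opprB addrC addrA subrK.
    rewrite (le_lt_trans (nrmB _ _))// (splitr e) mulrDr.
    by rewrite ltrD// (le_lt_trans (nrmX _ _))// HN.
  by rewrite ltr_pM2l// subr_gt0.
have /cvg_ex[/= L /cvg_nrmP SL] : cvg (S @ \oo) by exact: cauchy_cvg.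
have key (f : A -> A) : (forall u v, f u - f v = f (u - v)) ->
    (forall u, nrm (f u) <= nrm (1 - y) * nrm u) ->
    (forall n, f (S n) = 1 - y ^+ n) -> f L = 1.
  move=> fB fle fS; apply/eqP; rewrite -subr_eq0; apply/eqP.
  apply: nrm_le_eps => e e0; set c := nrm (1 - y) in fle.
  have c0 : 0 <= c := nrm_ge0 _.
  have [| |N HN] := @expr_small _ q (e / 2).
  - by rewrite q0.
  - exact: divr_gt0.
  have [M _ HM] : \forall n \near \oo, nrm (L - S n) < e / 2 / (c + 1).
    by apply: SL; rewrite !divr_gt0// ltr_wpDl.
  pose n := maxn N M.
  have -> : f L - 1 = f (L - S n) - y ^+ n.
    by rewrite -fB fS opprB -addrA (addrAC (y ^+ n)) subrr add0r.
  rewrite (le_trans (nrmB _ _))// (splitr e) lerD//.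
    have {}HM : nrm (L - S n) <= e / 2 / (c + 1).
      by apply/ltW/HM => /=; rewrite leq_maxr.
    rewrite (le_trans (fle _))// (le_trans (ler_wpM2l c0 HM))//.
    rewrite mulrC mulrAC ler_pdivrMr ?ltr_wpDl// ler_wpM2l ?lerDl//.
    by rewrite ltW// divr_gt0.
  by rewrite (le_trans (nrmX _ _))// ltW// HN// leq_maxl.
exists L; split.
  apply: (key (fun u => u * (1 - y))) => [u v|u|n]; first by rewrite mulrBl.
    by rewrite mulrC nrmM.
  by rewrite SC SE.
apply: (key (fun u => (1 - y) * u)) => [u v|u|n]; first by rewrite mulrBr.
  exact: nrmM.
exact: SE.
Qed.

(** The easy half of the spectral radius formula: if |x^k| < |lam|^k, then
    1 - (x / lam)^k is invertible by the Neumann series, hence so is its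
    divisor 1 - x / lam. *)
Lemma spectrum_modulus x lam : spectrum x lam ->
  forall k, modulus lam ^+ k <= nrm (x ^+ k).
Proof.
move=> lams k; rewrite leNgt; apply/negP => lt; apply: lams.
have lam0 : lam != 0.
  apply: contraTneq lt => ->; rewrite -leNgt.
  case: k => [|k]; first by rewrite !expr0 nrm1.
  by rewrite modulus0 expr0n nrm_ge0.
have -> : lam%:A - x = lam *: (1 - lam^-1 *: x).
  by rewrite scalerBr scalerA mulfV// scale1r.
apply: scale_invertible => //; apply: (@invertible_geometric _ _ k).
apply: neumann; rewrite exprZn nrmZ modulusX modulusV exprVn.
by rewrite mulrC ltr_pdivrMr ?mul1r// (le_lt_trans _ lt)// nrm_ge0.
Qed.

End BanachAlgebra.

(** * Roots of unity and averages of resolvents *)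

Section Cis.
Variable R : realType.

Definition cis (t : R) : R[i] := cos t +i* sin t.

Lemma cisD s t : cis (s + t) = cis s * cis t.
Proof. by rewrite /cis cosD sinD; simpc; congr (_ +i* _); ring. Qed.

Lemma cis0 : cis 0 = 1.
Proof. by rewrite /cis cos0 sin0. Qed.

Lemma cisX t n : cis t ^+ n = cis (n%:R * t).
Proof.
elim: n => [|n ih]; first by rewrite expr0 mul0r cis0.
by rewrite exprS ih -cisD -natr1 mulrDl mul1r addrC.
Qed.

Lemma modulus_cis t : modulus (cis t) = 1.
Proof. by rewrite /modulus normc_def/= cos2Dsin2 sqrtr1. Qed.

Lemma cis_dist s t :
  modulus (cis s - cis t) <= `|cos s - cos t| + `|sin s - sin t|.
Proof. exact: modulus_le. Qed.

Lemma cis_2pi : cis (2 * pi) = 1.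
Proof. by rewrite /cis mulr_natl cos2pi sin2pi. Qed.

(** 1 - cos (2 t) = 2 (sin t)^2. *)
Lemma cis_neq1 t : 0 < t < pi -> cis (2 * t) != 1.
Proof.
move=> /sin_gt0_pi st; apply/eqP => -[].
rewrite mulr_natl cos_mulr2n cos2sin2 => h _.
by have := exprn_gt0 2 st; lra.
Qed.

Definition root_of_unity n := cis (2 * (pi / n%:R)).

Lemma root_of_unityX n : (0 < n)%N -> root_of_unity n ^+ n = 1.
Proof.
move=> n0; rewrite cisX mulrCA (mulrCA n%:R) mulfV ?pnatr_eq0 -?lt0n//.
by rewrite mulr1 cis_2pi.
Qed.

Lemma root_of_unity_prim n k : (0 < k < n)%N -> root_of_unity n ^+ k != 1.
Proof.
move=> /andP[k0 kn]; rewrite cisX mulrCA cis_neq1//.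
have n0 : 0 < n%:R :> R by rewrite ltr0n (leq_trans _ kn).
rewrite mulr_gt0 ?ltr0n ?divr_gt0 ?pi_gt0//=.
by rewrite mulrCA gtr_pMr ?pi_gt0// ltr_pdivrMr// mul1r ltr_nat.
Qed.

End Cis.

Lemma sum_root_of_unity (R : realType) n k : (0 < k < n)%N ->
  \sum_(j < n) (root_of_unity R n ^+ j) ^+ k = 0.
Proof.
move=> kn; have n0 : (0 < n)%N by case/andP: kn => _; exact: leq_trans.
have /eqP : (root_of_unity R n ^+ k - 1) *
    (\sum_(j < n) (root_of_unity R n ^+ k) ^+ j) = 0.
  by rewrite -subrX1 exprAC root_of_unityX// expr1n subrr.
rewrite mulf_eq0 subr_eq0 (negbTE (root_of_unity_prim _ kn))/= => /eqP h.
by rewrite -[RHS]h; apply: eq_bigr => j _; rewrite exprAC.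
Qed.

Section Averages.
Variables (R : realType) (A : banachAlgType R[i]).
Implicit Types x y : A.

(** The partial fraction decomposition of 1 / (1 - y^n). As w^n = 1, the
    element r_j * (1 - y^n) is the geometric sum of the powers (w^j y)^k, k < n;
    averaging over j kills all of them but the one with k = 0. *)
Lemma average_inverse n y (r : nat -> A) : (0 < n)%N ->
  (forall j, (j < n)%N -> r j * (1 - root_of_unity R n ^+ j *: y) = 1) ->
  (n%:R^-1 *: \sum_(j < n) r j) * (1 - y ^+ n) = 1.
Proof.
move=> n0 hr; set w := root_of_unity R n in hr.
have E (j : 'I_n) : r j * (1 - y ^+ n) = \sum_(k < n) (w ^+ j) ^+ k *: y ^+ k.
  have -> : 1 - y ^+ n = (1 - w ^+ j *: y) * \sum_(k < n) (w ^+ j *: y) ^+ k.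
    rewrite -[1 - w ^+ j *: y]opprB mulNr -subrX1 opprB exprZn exprAC.
    by rewrite root_of_unityX// expr1n scale1r.
  by rewrite mulrA hr// mul1r; apply: eq_bigr => k _; rewrite exprZn.
rewrite -scalerAl mulr_suml (eq_bigr _ (fun j _ => E j)) exchange_big/=.
rewrite (bigD1 (Ordinal n0))//= [X in _ + X]big1; last first.
  move=> k k0; rewrite -scaler_suml sum_root_of_unity ?scale0r//.
  by rewrite ltn_ord andbT lt0n.
rewrite addr0 -scaler_suml expr0; under eq_bigr do rewrite expr0.
by rewrite sumr_const card_ord scalerA mulVf ?scale1r// pnatr_eq0 -lt0n.
Qed.

(** Here r z is the inverse of 1 - z y on the closed unit disc, where the
    spectral variable is z = 1 / lam. *)
Section Resolvent.
Variables (y : A) (r : R[i] -> A).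
Hypothesis rl : forall z : R[i], modulus z <= 1 -> r z * (1 - z *: y) = 1.
Hypothesis rr : forall z : R[i], modulus z <= 1 -> (1 - z *: y) * r z = 1.

(** The resolvent identity r u - r v = (u - v) r u y r v. *)
Lemma resolvent_dist (u v : R[i]) : modulus u <= 1 -> modulus v <= 1 ->
  nrm (r u - r v) <= modulus (u - v) * nrm y * nrm (r u) * nrm (r v).
Proof.
move=> hu hv.
have -> : r u - r v = (u - v) *: (r u * y * r v).
  transitivity (r u * ((1 - v *: y) - (1 - u *: y)) * r v).
    by rewrite mulrBr mulrBl -mulrA (rr hv) (rl hu) mulr1 mul1r.
  rewrite opprB addrC addrA subrK -scalerBl.
  by rewrite -scalerAr -scalerAl.
have -> : modulus (u - v) * nrm y * nrm (r u) * nrm (r v) =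
  modulus (u - v) * (nrm (r u) * nrm y * nrm (r v)) by ring.
rewrite nrmZ ler_wpM2l ?modulus_ge0// (le_trans (nrmM _ _))//.
by rewrite ler_wpM2r ?nrm_ge0// nrmM.
Qed.

(** For u close to v the resolvent identity gives |r u - r v| <= |r u| / 2, so
    |r u| <= 2 |r v|; this removes r u from the bound. *)
Lemma resolvent_dist2 (u v : R[i]) : modulus u <= 1 -> modulus v <= 1 ->
  modulus (u - v) * nrm y * nrm (r v) <= 2^-1 ->
  nrm (r u - r v) <= 2 * modulus (u - v) * nrm y * nrm (r v) ^+ 2.
Proof.
move=> hu hv huv; have d := resolvent_dist hu hv.
have : nrm (r u) <= 2 * nrm (r v).
  have : nrm (r u) <= nrm (r u - r v) + nrm (r v).
    by rewrite (le_trans _ (nrmD _ _))// subrK.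
  have := ler_wpM2l (nrm_ge0 (r u)) huv.
  lra.
move=> h; apply: (le_trans d).
have -> : 2 * modulus (u - v) * nrm y * nrm (r v) ^+ 2 =
  modulus (u - v) * nrm y * (2 * nrm (r v)) * nrm (r v) by ring.
by rewrite ler_wpM2r ?nrm_ge0// ler_wpM2l// mulr_ge0 ?modulus_ge0 ?nrm_ge0.
Qed.

Lemma resolvent_cis_continuous : continuous (fun t => nrm (r (cis t))).
Proof.
move=> t; apply/cvgrPdist_lt => e e0.
set N := nrm (r (cis t)); have N0 : 0 <= N := nrm_ge0 _.
have Y0 : 0 <= nrm y := nrm_ge0 _.
(* With d = min(1, e) / D, a variation E <= d of the point makes both E |y| N
   and E |y| N^2 at most min(1, e) / 4, which the local Lipschitz bound
   converts into a variation of the resolvent below e. *)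
pose D := 4 * (nrm y + 1) * (N + 1) ^+ 2.
have D0 : 0 < D by rewrite !mulr_gt0 ?exprn_gt0 ?ltr_wpDl.
pose d := Num.min 1 e / D.
have m0 : 0 < Num.min 1 e by rewrite lt_min ltr01.
have d0 : 0 < d by rewrite divr_gt0.
have dD : d * D = Num.min 1 e by rewrite /d divfK// gt_eqF.
have c := @continuous_cos R t; have s := @continuous_sin R t.
move/cvgrPdist_lt : c => /(_ _ (divr_gt0 d0 (ltr0n _ 2))) c.
move/cvgrPdist_lt : s => /(_ _ (divr_gt0 d0 (ltr0n _ 2))) s.
near=> u.
have ud : modulus (cis u - cis t) <= d.
  rewrite (le_trans (cis_dist _ _))// distrC [X in _ + X]distrC.
  by rewrite [leRHS]splitr lerD// ltW//; near: u.
have [m1 me] : Num.min 1 e <= 1 /\ Num.min 1 e <= e.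
  by rewrite !ge_min !lexx orbT.
set E := modulus _ in ud.
have E0 : 0 <= E := modulus_ge0 _.
have hN : E * nrm y * N ^+ 2 <= d * (nrm y + 1) * (N + 1) ^+ 2.
  rewrite ler_pM ?mulr_ge0 ?exprn_ge0//; first by rewrite ler_pM ?lerDl.
  by rewrite lerXn2r ?nnegrE ?addr_ge0 ?lerDl.
have hN1 : E * nrm y * N <= d * (nrm y + 1) * (N + 1) ^+ 2.
  rewrite ler_pM ?mulr_ge0//; first by rewrite ler_pM ?lerDl.
  by have := sqr_ge0 N; rewrite sqrrD; lra.
have dDE : d * (nrm y + 1) * (N + 1) ^+ 2 = Num.min 1 e / 4.
  by rewrite -dD /D; field.
have := @resolvent_dist2 (cis u) (cis t); rewrite !modulus_cis -/E -/N.
move=> /(_ (lexx _) (lexx _)) h.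
have {}h : nrm (r (cis u) - r (cis t)) < e.
  apply: le_lt_trans (h _) _; last by lra.
  by lra.
have h1 : N <= nrm (r (cis t) - r (cis u)) + nrm (r (cis u)).
  by rewrite (le_trans _ (nrmD _ _))// subrK.
have h2 : nrm (r (cis u)) <= nrm (r (cis u) - r (cis t)) + N.
  by rewrite (le_trans _ (nrmD _ _))// subrK.
rewrite nrm_distC in h1.
by rewrite ltr_norml; apply/andP; split; lra.
Unshelve. all: by end_near. Qed.

(** By compactness of the interval [0, 2 pi], the resolvent is bounded on the
    circle, in particular at all roots of unity at once. *)
Lemma resolvent_cis_bounded : exists2 M, 1 <= M &
  forall n j, (j < n)%N -> nrm (r (root_of_unity R n ^+ j)) <= M.
Proof.
have pi2 : 0 <= 2 * pi :> R by rewrite mulr_ge0 ?pi_ge0.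
have [c _ hc] := @EVT_max R _ 0 (2 * pi) pi2
  (continuous_subspaceT resolvent_cis_continuous).
exists (1 + nrm (r (cis c))); first by rewrite lerDl nrm_ge0.
move=> n j jn; have n0 : 0 < n%:R :> R by rewrite ltr0n (leq_trans _ jn).
rewrite cisX (le_trans (hc _ _)) ?lerDr// in_itv/=; apply/andP; split.
  by rewrite !mulr_ge0 ?pi_ge0 ?invr_ge0// ltW.
rewrite mulrCA ler_wpM2l// mulrCA ler_piMr ?pi_ge0//.
by rewrite ler_pdivrMr// mul1r ler_nat ltnW.
Qed.

(** The core of the spectral radius formula. For s < 1 let G and H be
    the left inverses of 1 - (s y)^n and 1 - y^n obtained by averaging the
    resolvent over the n points s w^j, respectively w^j. A choice of s close
    to 1 makes |H - G| small uniformly in n.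
    For fixed s, some large n makes (s y)^n small, hence G close to 1, hence H
    close to 1, and then y^n = (H - 1) - (H - 1) y^n has norm < 1. *)
Lemma power_lt1 :
  (forall s, 0 <= s < 1 -> exists k, s ^+ k * nrm (y ^+ k) < 1) ->
  exists n, nrm (y ^+ n) < 1.
Proof.
move=> ysmall; have [M M1 hM] := resolvent_cis_bounded.
have Y0 : 0 <= nrm y := nrm_ge0 _.
have M0 : 0 <= M by rewrite (le_trans _ M1).
(* D is chosen so that moving from w^j to s w^j, at distance d = 1 / D, changes
   the resolvent by at most 2 d |y| M^2 <= 1 / 8. *)
pose D := 16 * (nrm y + 1) * M ^+ 2.
have D16 : 16 <= D.
  rewrite /D -mulrA ler_peMr// -[leLHS]mulr1 ler_pM ?lerDr//.
  by rewrite exprn_ege1.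
have D0 : 0 < D by rewrite (lt_le_trans _ D16).
pose d := D^-1; have d0 : 0 < d by rewrite invr_gt0.
have d1 : d <= 1 by rewrite invf_le1// (le_trans _ D16)// ler1n.
have dD : d * (nrm y + 1) * M ^+ 2 = 1 / 16.
  by have := mulVf (lt0r_neq0 D0); rewrite -/d /D; lra.
pose s := 1 - d.
have s01 : 0 <= s < 1 by rewrite /s subr_ge0 d1/= ltrBlDr ltrDl.
have [k kq] := ysmall s s01.
have k0 : (0 < k)%N.
  by case: k kq => // ; rewrite !expr0 nrm1 mulr1 ltxx.
set q := s ^+ k * _ in kq.
have q0 : 0 <= q by rewrite mulr_ge0 ?nrm_ge0// exprn_ge0//; case/andP: s01.
(* powers of (s y)^k decrease geometrically, so n is a multiple of k *)
have [| |m hm] := @expr_small R q (1 / 16) ; [by rewrite q0|by lra|].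
pose n := (k * m.+1)%N.
have n0 : (0 < n)%N by rewrite muln_gt0 k0.
exists n.
have hs : modulus s%:C = s by rewrite modulus_real ger0_norm//; case/andP: s01.
pose y' := s%:C *: y.
have y'n : nrm (y' ^+ n) <= 1 / 16.
  rewrite /n exprM (le_trans (nrmX _ _))// ltW// (le_lt_trans _ (hm m.+1 _))//.
  by rewrite lerXn2r ?nnegrE ?nrm_ge0// /y' exprZn nrmZ modulusX hs.
pose w := root_of_unity R n.
have w1 j : modulus (w ^+ j) = 1 by rewrite modulusX modulus_cis expr1n.
have sw1 j : modulus (s%:C * w ^+ j) <= 1.
  by rewrite modulusM hs w1 mulr1; case/andP: s01 => _ /ltW.
pose G := n%:R^-1 *: \sum_(j < n) r (s%:C * w ^+ j).
pose H := n%:R^-1 *: \sum_(j < n) r (w ^+ j).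
have GE : G * (1 - y' ^+ n) = 1.
  apply: (@average_inverse n y' (fun j => r (s%:C * w ^+ j))) => // j jn.
  by rewrite /y' scalerA -/w [w ^+ j * _]mulrC rl.
have HE : H * (1 - y ^+ n) = 1.
  apply: (@average_inverse n y (fun j => r (w ^+ j))) => // j jn.
  by rewrite rl// w1.
have GH : nrm (H - G) <= 1 / 8.
  rewrite /G /H -scalerBr -sumrB nrmZ modulusV.
  have -> : modulus (n%:R : R[i]) = n%:R.
    by rewrite -[n%:R](rmorph_nat (real_complex R)) modulus_real normr_nat.
  rewrite mulrC ler_pdivrMr ?ltr0n// (le_trans (nrm_sum _ _ _))//.
  rewrite mulr_natr -[X in _ *+ X]card_ord -sumr_const ler_sum// => j _.
  have ws : modulus (s%:C * w ^+ j - w ^+ j) = d.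
    rewrite -[X in _ - X]mul1r -mulrBl modulusM w1 mulr1.
    rewrite -(rmorph1 (real_complex R)) -rmorphB modulus_real /s.
    by rewrite addrAC subrr add0r normrN gtr0_norm.
  set N := nrm (r (w ^+ j)); have NM : N <= M by exact: hM.
  have N0 : 0 <= N := nrm_ge0 _.
  have hN : d * nrm y * N ^+ 2 <= d * (nrm y + 1) * M ^+ 2.
    rewrite ler_pM ?mulr_ge0 ?exprn_ge0//; try by rewrite ltW.
      by rewrite ler_pM ?lerDl// ltW.
    by rewrite lerXn2r ?nnegrE ?addr_ge0 ?lerDl.
  have hN1 : d * nrm y * N <= d * (nrm y + 1) * M ^+ 2.
    rewrite ler_pM ?mulr_ge0//; try by rewrite ltW.
      by rewrite ler_pM ?lerDl// ltW.
    by rewrite (le_trans NM)// expr2 ler_peMr.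
  have := @resolvent_dist2 (s%:C * w ^+ j) (w ^+ j); rewrite w1 ws -/N.
  move=> /(_ (sw1 _) (lexx _)) h.
  by rewrite nrm_distC; apply: le_trans (h _) _; lra.
have G1 : nrm (G - 1) <= 1 / 8.
  have E : G - 1 = G * y' ^+ n.
    by apply/eqP; rewrite subr_eq addrC -subr_eq -{1}[G]mulr1 -mulrBr GE.
  have h : nrm (G - 1) <= nrm G * (1 / 16).
    by rewrite E (le_trans (nrmM _ _))// ler_wpM2l ?nrm_ge0.
  have : nrm G <= nrm (G - 1) + 1.
    by rewrite -[X in _ + X](nrm1 A) (le_trans _ (nrmD _ _))// subrK.
  by have := nrm_ge0 G; lra.
have H1 : nrm (H - 1) <= 1 / 4.
  have : nrm (H - 1) <= nrm (H - G) + nrm (G - 1).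
    by rewrite (le_trans _ (nrmD _ _))// addrA subrK.
  lra.
have E : y ^+ n = (H - 1) - (H - 1) * y ^+ n.
  have E1 : H - 1 = H * y ^+ n.
    by apply/eqP; rewrite subr_eq addrC -subr_eq -{1}[H]mulr1 -mulrBr HE.
  by rewrite {1}E1 mulrBl mul1r opprB addrC subrK.
have : nrm (y ^+ n) <= nrm (H - 1) + nrm (H - 1) * nrm (y ^+ n).
  by rewrite {1}E (le_trans (nrmB _ _))// lerD2l nrmM.
have := ler_wpM2r (nrm_ge0 (y ^+ n)) H1.
by have := nrm_ge0 (y ^+ n); lra.
Qed.

End Resolvent.

End Averages.

(** * The spectral radius *)

Section SpectralRadius.
Variables (R : realType) (A : banachAlgType R[i]).
Implicit Types x y : A.

(** 1 = x^k z^k. *)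
Lemma nrm_invertible x z k : z * x = 1 -> x * z = 1 ->
  1 <= nrm (x ^+ k) * nrm (z ^+ k).
Proof.
move=> zx xz; rewrite -[leLHS](nrm1 A).
have -> : 1 = x ^+ k * z ^+ k.
  by rewrite -exprMn_comm ?xz ?expr1n// /GRing.comm xz zx.
exact: nrmM.
Qed.

Lemma not_spectrum x lam : ~ spectrum x lam -> invertible (lam%:A - x).
Proof. by move=> /contrapT. Qed.

Lemma spectrum0 x : spectrum x 0 <-> ~ invertible x.
Proof.
rewrite /spectrum/= scale0r sub0r; split=> h hx; apply: h.
  by rewrite -scaleN1r; apply: scale_invertible => //;
    rewrite oppr_eq0 oner_eq0.
have -> : x = (-1) *: (- x) by rewrite scaleN1r opprK.
by apply: scale_invertible => //; rewrite oppr_eq0 oner_eq0.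
Qed.

(** The supremum of this set is inf_k |x^k|^(1/k); working with the set
    avoids roots. *)
Let lower x := [set t : R | 0 <= t /\ forall k, t ^+ k <= nrm (x ^+ k)].

Lemma lower_has_sup x : has_sup (lower x).
Proof.
split.
  exists 0; split => // -[|k]; first by rewrite !expr0 nrm1.
  by rewrite expr0n nrm_ge0.
by exists (nrm x) => t [_ /(_ 1%N)]; rewrite !expr1.
Qed.

(** The supremum belongs to the set, by continuity of the powers. *)
Lemma lower_sup x : lower x (sup (lower x)).
Proof.
have hs := lower_has_sup x.
have nu0 : 0 <= sup (lower x).
  apply: sup_upper_bound => //; split => // -[|k].
    by rewrite !expr0 nrm1.
  by rewrite expr0n nrm_ge0.
split => // k; rewrite leNgt; apply/negP => lt.
have := @exprn_continuous R k (sup (lower x)).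
move/cvgrPdist_lt => /(_ (sup (lower x) ^+ k - nrm (x ^+ k))).
rewrite subr_gt0 => /(_ lt) /nbhs_ballP[e /= e0 he].
have [t [t0 tk] et] := sup_adherent e0 hs.
have : ball (sup (lower x)) e t.
  rewrite /ball/= ger0_norm ?subr_ge0 ?sup_upper_bound//.
  by rewrite ltrBlDr -ltrBlDl.
move=> /he /=; rewrite ltr_norml => /andP[_].
by have := tk k; lra.
Qed.

(** The hard half of the spectral radius formula; with t = 0 it says that the
    spectrum is not empty. Let nu be the largest admissible t. If nu = 0, then
    x is not invertible, as an inverse z would make 1 / |z| admissible. If
    nu > 0 and the spectrum lies in |lam| < nu, then y = x / nu satisfies the
    hypotheses of [power_lt1], whereas |y^n| >= 1 for all n. *)
Lemma spectrum_ge x t : 0 <= t -> (forall k, t ^+ k <= nrm (x ^+ k)) ->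
  exists2 mu, spectrum x mu & t <= modulus mu.
Proof.
move=> t0 tx; have hs := lower_has_sup x; have [nu0 nux] := lower_sup x.
set nu := sup (lower x) in nu0 nux.
have tnu : t <= nu by apply: sup_upper_bound.
suff [mu mus le] : exists2 mu, spectrum x mu & nu <= modulus mu.
  by exists mu => //; exact: le_trans le.
have {tx tnu t0 t} numax s : nu < s -> exists k, nrm (x ^+ k) < s ^+ k.
  move=> nus; apply: contrapT => h.
  have : lower x s.
    split; first by rewrite (le_trans nu0)// ltW.
    by move=> k; rewrite leNgt; apply/negP => lt; apply: h; exists k.
  by move/(sup_upper_bound hs); rewrite leNgt nus.
move: nu0; rewrite le_eqVlt => /predU1P[nu0|nu0].
  exists 0; last by rewrite -nu0 modulus_ge0.
  apply/spectrum0 => -[z [zx xz]].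
  have zn : 0 < nrm z.
    have := nrm_invertible 1 zx xz; rewrite !expr1 lt_neqAle nrm_ge0 andbT.
    apply: contraTN => /eqP <-; by rewrite mulr0 ler10.
  have [|k] := numax (nrm z)^-1; first by rewrite -nu0 invr_gt0.
  rewrite exprVn; apply/negP; rewrite -leNgt.
  rewrite -[X in X <= _]mul1r ler_pdivrMr ?exprn_gt0//.
  rewrite (le_trans (nrm_invertible k zx xz))//.
  by rewrite ler_wpM2l ?nrm_ge0// nrmX.
apply: contrapT => hn.
have inv mu : nu <= modulus mu -> invertible (mu%:A - x).
  by move=> h; apply: not_spectrum => s; apply: hn; exists mu.
pose y := (nu^-1)%:C *: x.
have yk k : nrm (y ^+ k) = nrm (x ^+ k) / nu ^+ k.
  rewrite /y exprZn nrmZ modulusX modulus_real ger0_norm ?invr_ge0 ?ltW//.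
  by rewrite mulrC exprVn.
have invy (z : R[i]) : exists w : A, modulus z <= 1 ->
    w * (1 - z *: y) = 1 /\ (1 - z *: y) * w = 1.
  have [z1|] := boolP (modulus z <= 1); last by exists 0.
  suff [w hw] : invertible (1 - z *: y) by exists w.
  have [->|z0] := eqVneq z 0.
    by rewrite scale0r subr0; exists 1; rewrite mulr1.
  have nuC : nu%:C != 0 :> R[i] by rewrite (inj_eq (@complexI R)) gt_eqF.
  have -> : 1 - z *: y = (z / nu%:C) *: ((nu%:C / z)%:A - x).
    rewrite /y scalerBr !scalerA fmorphV/=.
    by rewrite mulrA divfK// mulfV// scale1r.
  apply: scale_invertible; first by rewrite mulf_neq0// invr_eq0.
  apply: inv; rewrite modulusM modulusV modulus_real gtr0_norm//.
  rewrite ler_pdivlMr; first by rewrite ler_piMr// ltW.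
  by rewrite modulus_gt0.
have [r hr] := choice invy.
have [||s /andP[s0 s1]|n] := @power_lt1 R A y r.
- by move=> z /hr[].
- by move=> z /hr[].
- move: s0; rewrite le_eqVlt => /predU1P[<-|s0].
    by exists 1%N; rewrite expr1 mul0r.
  (* nu / s > nu is not admissible *)
  have [|k hk] := numax (nu / s).
    by rewrite ltr_pdivlMr// gtr_pMr.
  exists k; rewrite yk mulrA ltr_pdivrMr ?exprn_gt0// mul1r.
  by move: hk; rewrite expr_div_n ltr_pdivlMr ?exprn_gt0// mulrC.
rewrite yk ltr_pdivrMr ?exprn_gt0// mul1r ltNge.
by rewrite nux.
Qed.

(** mu - z = - mu z (1 / mu - x) when z is the inverse of x. *)
Lemma spectrum_inverse x z mu : z * x = 1 -> x * z = 1 -> spectrum z mu ->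
  mu != 0 /\ spectrum x mu^-1.
Proof.
move=> zx xz muz.
have mu0 : mu != 0.
  apply/eqP => mu0; move: muz; rewrite mu0 => /spectrum0; apply.
  by exists x.
split => // h; apply: muz.
have -> : mu%:A - z = - mu *: (z * (mu^-1%:A - x)).
  rewrite mulrBr zx -scalerAr mulr1 scalerBr scalerA mulNr mulfV//.
  by rewrite scaleN1r scaleNr opprK addrC.
apply: scale_invertible; first by rewrite oppr_eq0.
by apply: invertibleM => //; exists x.
Qed.

(** The radii are the infimum and the supremum of the moduli of the spectrum,
    which is nonempty and bounded; every annulus containing the spectrum has
    radii beyond these bounds. *)
Lemma smallest_annulus_spectrum x : exists r1 r2 : R,
  [/\ smallest_annulus (spectrum x) (annulus r1 r2),
      forall t, 0 <= t -> (forall k, t ^+ k <= nrm (x ^+ k)) -> t <= r2 &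
      forall mu, spectrum x mu -> r1 <= modulus mu].
Proof.
pose S := @modulus R @` spectrum x.
have S0 : S !=set0.
  have [//||mu hmu _] := @spectrum_ge x 0; last by exists (modulus mu), mu.
  move=> [|k]; first by rewrite !expr0 nrm1.
  by rewrite expr0n nrm_ge0.
have Sle mu : spectrum x mu -> modulus mu <= nrm x.
  by move=> /spectrum_modulus /(_ 1%N); rewrite !expr1.
have Ss : has_sup S.
  by split=> //; exists (nrm x) => _ [mu hmu <-]; exact: Sle.
have Si : has_inf S.
  by split=> //; exists 0 => _ [mu hmu <-]; exact: modulus_ge0.
have les mu : spectrum x mu -> modulus mu <= sup S.
  by move=> h; apply: sup_upper_bound => //; exists mu.
have lei mu : spectrum x mu -> inf S <= modulus mu.
  by move=> h; apply: (ge_inf Si.2); exists mu.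
exists (inf S), (sup S); split => //.
  split.
  - exists (inf S), (sup S); split => //.
      by apply: lb_le_inf => // _ [mu hmu <-]; exact: modulus_ge0.
    by have [_ [mu hmu _]] := S0; rewrite (le_trans (lei _ hmu))// les.
  - by move=> mu hmu; rewrite /annulus/= lei// les.
  - move=> _ [r1 [r2 [r10 r12 ->]]] sub mu /= /andP[h1 h2].
    apply/andP; split.
      rewrite (le_trans _ h1)//; apply: lb_le_inf => //.
      by move=> _ [nu /sub/andP[? ?] <-].
    rewrite (le_trans h2)//; apply: ge_sup => //.
    by move=> _ [nu /sub/andP[? ?] <-].
move=> t t0 tk; have [mu hmu h] := spectrum_ge t0 tk.
by rewrite (le_trans h)// les.
Qed.

End SpectralRadius.

(** * Weighted supremum norms *)

(** The data of a Banach space of functions f : I -> V bounded by a multiple of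
    a weight: a subspace [carrier] closed for the supremum of |f i| / weight i.
    Weights may vanish, which forces f i = 0. The spaces of families below and
    the spaces of bounded operators are both of this kind. *)
Record weighted (R : realType) (I : Type) (V : normedModType R[i]) := Weighted {
  weight : I -> R ;
  weight_ge0 : forall i, 0 <= weight i ;
  carrier : set (I -> V) ;
  carrier0 : carrier 0 ;
  carrierL : forall (c : R[i]) (f g : I -> V),
    carrier f -> carrier g -> carrier (c *: f + g) ;
  carrier_closed : forall l : I -> V,
    (forall e : R, 0 < e ->
      exists2 g, carrier g & forall i, nrm (g i - l i) <= e * weight i) ->
    carrier l
}.

Section WeightedSup.
Variables (R : realType) (I : Type) (V : completeNormedModType R[i]).
Variable W : weighted I V.
Local Notation w := (weight W).

(** The norm is the least element of this set; it is the supremum of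
    |f i| / weight i with the quotients cleared, as weights may vanish. *)
Definition wbounded (f : I -> V) : set R :=
  [set M | 0 <= M /\ forall i, nrm (f i) <= M * w i].

Definition wpred : {pred I -> V} :=
  [pred f | `[< carrier W f /\ wbounded f !=set0 >]].

Record wsup := Wsup { wfun :> I -> V ; _ : wfun \in wpred }.

HB.instance Definition _ := [isSub for wfun].
HB.instance Definition _ := [Choice of wsup by <:].

Lemma wsupP (f : wsup) : carrier W f /\ wbounded f !=set0.
Proof. by case: f => f /= /asboolP. Qed.

Lemma wboundedL (c : R[i]) (f g : I -> V) M N : wbounded f M -> wbounded g N ->
  wbounded (c *: f + g) (modulus c * M + N).
Proof.
move=> [M0 hM] [N0 hN]; split; first by rewrite addr_ge0 ?mulr_ge0 ?modulus_ge0.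
move=> i; rewrite (le_trans (nrmD _ _))// mulrDl lerD// nrmZ -mulrA.
by rewrite ler_wpM2l ?modulus_ge0.
Qed.

Lemma wpred_submod : submod_closed wpred.
Proof.
split.
  apply/asboolP; split; first exact: carrier0.
  by exists 0; split => // i; rewrite mul0r nrm0.
move=> c f g /asboolP[Wf [M fM]] /asboolP[Wg [N gN]]; apply/asboolP.
split; first exact: carrierL.
by exists (modulus c * M + N); exact: wboundedL.
Qed.

HB.instance Definition _ := GRing.isSubmodClosed.Build _ _ wpred wpred_submod.
HB.instance Definition _ := [SubChoice_isSubLmodule of wsup by <:].

Definition wnorm (f : wsup) : R := inf (wbounded f).

Lemma wbounded_has_inf (f : wsup) : has_inf (wbounded f).
Proof. by split; [case: (wsupP f)|exists 0 => M []]. Qed.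

Lemma wnorm_le (f : wsup) M : 0 <= M -> (forall i, nrm (f i) <= M * w i) ->
  wnorm f <= M.
Proof. by move=> M0 hM; apply: (ge_inf (wbounded_has_inf f).2). Qed.

Lemma wnorm_ge0 (f : wsup) : 0 <= wnorm f.
Proof. by apply: lb_le_inf => [|M []//]; case: (wbounded_has_inf f). Qed.

(** The infimum that defines the norm is attained. *)
Lemma wnormP (f : wsup) i : nrm (f i) <= wnorm f * w i.
Proof.
have [M [M0 hM]] := (wbounded_has_inf f).1.
have := weight_ge0 W i; rewrite le_eqVlt => /predU1P[w0|w0].
  by have := hM i; rewrite -w0 !mulr0.
rewrite -ler_pdivrMr//; apply: lb_le_inf; first by exists M.
by move=> N [_ hN]; rewrite ler_pdivrMr.
Qed.

Lemma wnormD (f g : wsup) : wnorm (f + g) <= wnorm f + wnorm g.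
Proof.
apply: wnorm_le; first by rewrite addr_ge0 ?wnorm_ge0.
by move=> i; rewrite mulrDl (le_trans (nrmD _ _))// lerD// wnormP.
Qed.

Lemma wnormZ_le (c : R[i]) (f : wsup) : wnorm (c *: f) <= modulus c * wnorm f.
Proof.
apply: wnorm_le; first by rewrite mulr_ge0 ?modulus_ge0 ?wnorm_ge0.
by move=> i; rewrite nrmZ -mulrA ler_wpM2l ?modulus_ge0// wnormP.
Qed.

Lemma wnormZ (c : R[i]) (f : wsup) : wnorm (c *: f) = modulus c * wnorm f.
Proof.
apply/eqP; rewrite eq_le wnormZ_le/=.
have [->|c0] := eqVneq c 0; first by rewrite modulus0 mul0r wnorm_ge0.
have cp : 0 < modulus c by rewrite modulus_gt0.
rewrite mulrC -ler_pdivlMr// mulrC -modulusV.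
by rewrite (le_trans _ (wnormZ_le _ _))// scalerA mulVf// scale1r.
Qed.

Lemma wnorm_eq0 (f : wsup) : wnorm f = 0 -> f = 0.
Proof.
move=> f0; apply/val_inj/funext => i /=; apply/eqP; rewrite -nrm_eq0.
by rewrite eq_le nrm_ge0 andbT; have := wnormP f i; rewrite f0 mul0r.
Qed.

Definition wnormC (f : wsup) : R[i] := (wnorm f)%:C.

Lemma wnormC_triangle f g : wnormC (f + g) <= wnormC f + wnormC g.
Proof. by rewrite /wnormC -rmorphD lecR wnormD. Qed.

Lemma wnormCZ (c : R[i]) f : wnormC (c *: f) = `|c| * wnormC f.
Proof. by rewrite /wnormC wnormZ rmorphM/= modulusE -nrmE. Qed.

Lemma wnormC_eq0 f : wnormC f = 0 -> f = 0.
Proof. by move=> [] /wnorm_eq0. Qed.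

HB.instance Definition _ := Lmodule_isNormed.Build R[i] wsup
  wnormC_triangle wnormCZ wnormC_eq0.

Lemma nrm_wsup (f : wsup) : nrm f = wnorm f. Proof. by []. Qed.

(** The limit l of a Cauchy filter is taken pointwise. Passing to the limit in
    |g i - f i| <= e * weight i gives the same bound for g i - l i, uniformly in
    i, so l is in the closed carrier and is also the limit in norm. *)
Lemma wsup_complete (F : set_system wsup) :
  ProperFilter F -> cauchy F -> cvg F.
Proof.
move=> FF Fc.
have evc i : cvg ((fun f : wsup => f i) @ F).
  apply: cauchy_cvg; apply: cauchy_nrmP => e e0.
  have w1 : 0 < w i + 1 by rewrite ltr_wpDl ?weight_ge0.
  have [g Fg] := cauchy_nrm Fc (divr_gt0 e0 w1).
  exists (g i); rewrite near_simpl; near=> f.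
  rewrite (@le_lt_trans _ _ (nrm (g - f) * w i))//.
    exact: wnormP (g - f) i.
  have : nrm (g - f) < e / (w i + 1) by near: f.
  rewrite ltr_pdivlMr// => h; rewrite (le_lt_trans _ h)//.
  by rewrite ler_wpM2l ?nrm_ge0// lerDl.
pose l i := lim ((fun f : wsup => f i) @ F).
have approx (e : R) : 0 < e -> exists g : wsup,
    (forall i, nrm (g i - l i) <= e * w i) /\
    \forall f \near F, nrm (g - f) < e.
  move=> e0; have [g Fg] := cauchy_nrm Fc e0; exists g; split => // i.
  apply/ler_addgt0Pr => d d0.
  have /cvg_nrmP/(_ d d0) Fl := evc i.
  near F => f.
  have -> : g i - l i = (g i - f i) - (l i - f i) by rewrite opprB addrA subrK.
  rewrite (le_trans (nrmB _ _))// lerD//.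
    rewrite (le_trans (wnormP (g - f) i))// ler_wpM2r ?weight_ge0// ltW//.
    by rewrite -nrm_wsup; near: f.
  by rewrite ltW//; near: f.
have lS : l \in wpred.
  apply/asboolP; split.
    apply: carrier_closed => e /approx[g [gl _]]; exists g => //.
    by case: (wsupP g).
  have [g [gl _]] := approx 1 ltr01.
  exists (wnorm g + 1); split; first by rewrite addr_ge0 ?wnorm_ge0.
  move=> i; rewrite mulrDl.
  have -> : l i = g i - (g i - l i) by rewrite opprB addrC subrK.
  by rewrite (le_trans (nrmB _ _))// lerD// wnormP.
apply/cvg_ex; exists (Wsup lS); apply/cvg_nrmP => e e0.
have e2 : 0 < e / 2 by rewrite divr_gt0.
have [g [gl Fg]] := approx _ e2.
near=> f.
have -> : Wsup lS - f = (Wsup lS - g) + (g - f) by rewrite addrA subrK.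
rewrite (le_lt_trans (nrmD _ _))// [ltRHS]splitr ler_ltD//; last by near: f.
apply: wnorm_le; first exact: ltW.
by move=> i; rewrite /= nrm_distC.
Unshelve. all: by end_near. Qed.

HB.instance Definition _ := Uniform_isComplete.Build wsup wsup_complete.

End WeightedSup.

(** * The Banach algebra of bounded operators *)

Section BoundedOperators.
Variables (R : realType) (V : completeNormedModType R[i]).

Definition linear_maps : set (V -> V) :=
  [set f | forall (c : R[i]) u v, f (c *: u + v) = c *: f u + f v].

Lemma linear_maps0 : linear_maps 0.
Proof. by move=> c u v; rewrite -[RHS]/(c *: 0 + 0) scaler0 addr0. Qed.

Lemma linear_mapsL (c : R[i]) f g :
  linear_maps f -> linear_maps g -> linear_maps (c *: f + g).
Proof.
move=> hf hg d u v.
have E w : (c *: f + g) w = c *: f w + g w by [].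
by rewrite !E hf hg !scalerDr !scalerA [c * d]mulrC addrACA.
Qed.

(** The defect of linearity of l at given vectors is at most e, up to a
    constant that depends on these vectors, since it vanishes for the linear
    approximations of l. *)
Lemma linear_maps_closed (l : V -> V) :
  (forall e : R, 0 < e ->
    exists2 g, linear_maps g & forall v, nrm (g v - l v) <= e * nrm v) ->
  linear_maps l.
Proof.
move=> h c u v; apply/eqP; rewrite -subr_eq0; apply/eqP.
apply: nrm_le_eps => e e0.
pose D := nrm (c *: u + v) + modulus c * nrm u + nrm v + 1.
have D0 : 0 < D.
  by rewrite ltr_wpDl// !addr_ge0 ?mulr_ge0 ?nrm_ge0 ?modulus_ge0.
have [g gL gl] := h _ (divr_gt0 e0 D0).
have -> : l (c *: u + v) - (c *: l u + l v) =
    c *: (g u - l u) + (g v - l v) - (g (c *: u + v) - l (c *: u + v)).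
  rewrite gL scalerBr (addrACA (c *: g u)) -opprD [RHS]addrC opprB.
  by rewrite addrA subrK.
have h1 := gl (c *: u + v).
have h2 : nrm (c *: (g u - l u) + (g v - l v)) <=
    modulus c * (e / D * nrm u) + e / D * nrm v.
  rewrite (le_trans (nrmD _ _))// lerD// nrmZ.
  by rewrite ler_wpM2l ?modulus_ge0.
rewrite (le_trans (nrmB _ _))// (le_trans (lerD h2 h1))//.
have eD : e / D * D = e by rewrite divfK// gt_eqF.
rewrite -[leRHS]eD; have : 0 <= e / D by rewrite ltW// divr_gt0.
rewrite /D; set x := e / _ => x0; lra.
Qed.

(** For the weight v |-> |v| the weighted supremum norm is the operator norm. *)
Definition operators : weighted V V :=
  @Weighted R V V (@nrm R V) (@nrm_ge0 R V) linear_maps linear_maps0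
    linear_mapsL linear_maps_closed.

Definition bounded_op := wsup operators.

HB.instance Definition _ := CompleteNormedModule.on bounded_op.

Implicit Types f g h : bounded_op.

Lemma bounded_opL f (c : R[i]) u v : f (c *: u + v) = c *: f u + f v.
Proof. by case: (wsupP f) => fL _; exact: fL. Qed.

Lemma bounded_opP f v : nrm (f v) <= nrm f * nrm v.
Proof. exact: (wnormP f v). Qed.

Lemma bounded_op_norm_le f M : 0 <= M -> (forall v, nrm (f v) <= M * nrm v) ->
  nrm f <= M.
Proof. exact: wnorm_le. Qed.

Lemma bounded_op_memP (F : V -> V) M : linear_maps F -> 0 <= M ->
  (forall v, nrm (F v) <= M * nrm v) -> F \in wpred operators.
Proof. by move=> FL M0 FM; apply/asboolP; split => //; exists M. Qed.

Lemma bounded_op_id_subproof : id \in wpred operators.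
Proof. by apply: (@bounded_op_memP _ 1) => // v; rewrite mul1r. Qed.

Definition bounded_op_id : bounded_op := Wsup bounded_op_id_subproof.

Lemma bounded_op_comp_bound f g v : nrm (f (g v)) <= (nrm f * nrm g) * nrm v.
Proof.
rewrite (le_trans (bounded_opP _ _))// -mulrA ler_wpM2l ?nrm_ge0//.
exact: bounded_opP.
Qed.

Lemma bounded_op_comp_subproof f g : (f \o g : V -> V) \in wpred operators.
Proof.
apply: (@bounded_op_memP _ (nrm f * nrm g)).
- by move=> c u v /=; rewrite !bounded_opL.
- by rewrite mulr_ge0 ?nrm_ge0.
- exact: bounded_op_comp_bound.
Qed.

Definition bounded_op_comp f g : bounded_op :=
  Wsup (bounded_op_comp_subproof f g).

Lemma bounded_op_ext f g : (forall v, f v = g v) -> f = g.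
Proof. by move=> fg; apply/val_inj/funext. Qed.

Lemma bounded_op_compA : associative bounded_op_comp.
Proof. by move=> f g h; apply: bounded_op_ext. Qed.

Lemma bounded_op_comp1l : left_id bounded_op_id bounded_op_comp.
Proof. by move=> f; apply: bounded_op_ext. Qed.

Lemma bounded_op_comp1r : right_id bounded_op_id bounded_op_comp.
Proof. by move=> f; apply: bounded_op_ext. Qed.

Lemma bounded_op_compDl : left_distributive bounded_op_comp +%R.
Proof. by move=> f g h; apply: bounded_op_ext. Qed.

Lemma bounded_op_compDr : right_distributive bounded_op_comp +%R.
Proof.
move=> f g h; apply: bounded_op_ext => v /=.
by have := bounded_opL f 1 (g v) (h v); rewrite !scale1r.
Qed.

Lemma bounded_op_compZl (c : R[i]) f g :
  c *: bounded_op_comp f g = bounded_op_comp (c *: f) g.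
Proof. by apply: bounded_op_ext. Qed.

Lemma bounded_op_compZr (c : R[i]) f g :
  c *: bounded_op_comp f g = bounded_op_comp f (c *: g).
Proof.
apply: bounded_op_ext => v /=.
have f0 : f 0 = 0.
  by have := bounded_opL f (-1) 0 0; rewrite scaler0 addr0 scaleN1r addNr.
by have := bounded_opL f c (g v) 0; rewrite f0 !addr0.
Qed.

Lemma bounded_op_normM f g : `|bounded_op_comp f g| <= `|f| * `|g|.
Proof.
rewrite !nrmE -rmorphM lecR; apply: bounded_op_norm_le.
  by rewrite mulr_ge0 ?nrm_ge0.
exact: bounded_op_comp_bound.
Qed.

Hypothesis V_neq0 : exists v : V, v != 0.

Lemma bounded_op_norm1 : `|bounded_op_id| = 1.
Proof.
rewrite nrmE; congr _%:C; apply/eqP; rewrite eq_le; apply/andP; split.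
  by apply: bounded_op_norm_le => // v; rewrite mul1r.
have [v v0] := V_neq0; have := bounded_opP bounded_op_id v.
by rewrite -[X in X <= _]mul1r ler_pM2r// lt_neqAle eq_sym nrm_eq0 v0 nrm_ge0.
Qed.

(** The hypothesis that V is not zero is what gives the identity norm 1. *)
Definition op_algebra : banachAlgType R[i] :=
  HB.pack_for (banachAlgType R[i]) bounded_op
    (CompleteNormedModule_isBanachAlgebra.Build R[i] bounded_op
      bounded_op_compA bounded_op_comp1l bounded_op_comp1r
      bounded_op_compDl bounded_op_compDr bounded_op_compZl bounded_op_compZr
      bounded_op_norm1 bounded_op_normM).

Lemma op_algebra_mulE (f g : op_algebra) v :
  (f * g : bounded_op) v = (f : bounded_op) ((g : bounded_op) v).
Proof. by []. Qed.

Lemma op_algebra_expE (f : op_algebra) n v :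
  (f ^+ n : bounded_op) v = iter n (f : bounded_op) v.
Proof. by elim: n => //= n ih; rewrite exprS op_algebra_mulE ih. Qed.

(** An eigenvector is killed by lam - f, which is then not left invertible. *)
Lemma eigenvector_spectrum (f : op_algebra) (lam : R[i]) (v : V) : v != 0 ->
  (f : bounded_op) v = lam *: v -> spectrum f lam.
Proof.
move=> v0 fv [g [gl _]]; move/eqP: v0; apply.
have fv0 : ((lam%:A - f) : bounded_op) v = 0.
  transitivity (lam *: v - (f : bounded_op) v); first by [].
  by rewrite fv subrr.
have gv : (g : bounded_op) 0 = v.
  by rewrite -fv0; exact: (congr1 (fun h : bounded_op => h v) gl).
rewrite -gv; have := bounded_opL (g : bounded_op) (-1) 0 0.
by rewrite scaler0 addr0 scaleN1r addNr.
Qed.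

End BoundedOperators.

(** * Weighted shift operators *)

Section Shift.
Variables (R : realType) (T : Type) (w : T -> R).
Hypothesis w_ge0 : forall t, 0 <= w t.
Variable t0 : T.
Hypothesis w_t0 : w t0 = 1.

Definition all_families : weighted T (cplx R) :=
  @Weighted R T (cplx R) w w_ge0 setT Logic.I (fun _ _ _ _ _ => Logic.I)
    (fun _ _ => Logic.I).

Definition linfty := wsup all_families.
HB.instance Definition _ := CompleteNormedModule.on linfty.

Lemma linfty_memP (phi : T -> cplx R) M : 0 <= M ->
  (forall t, nrm (phi t) <= M * w t) -> phi \in wpred all_families.
Proof. by move=> M0 hM; apply/asboolP; split => //; exists M. Qed.

Lemma linftyP (phi : linfty) t : nrm (phi t) <= nrm phi * w t.
Proof. exact: (wnormP phi t). Qed.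

Lemma linfty_norm_le (phi : linfty) M : 0 <= M ->
  (forall t, nrm (phi t) <= M * w t) -> nrm phi <= M.
Proof. exact: wnorm_le. Qed.

Lemma weight_subproof : (fun t => (w t)%:C : cplx R) \in wpred all_families.
Proof.
apply: (@linfty_memP _ 1) => // t.
by rewrite mul1r -[nrm _]/(modulus _) modulus_real ger0_norm.
Qed.

(** The weight itself is a vector of norm at most 1; the powers of a shift
    attain their norms on it. *)
Definition weight_family : linfty := Wsup weight_subproof.

Lemma weight_family_norm : nrm weight_family <= 1.
Proof.
apply: linfty_norm_le => // t.
by rewrite mul1r -[nrm _]/(modulus _) modulus_real ger0_norm.
Qed.

Lemma family_neq0 (phi : linfty) t : phi t != 0 -> phi != 0.
Proof. by apply: contraNneq => ->. Qed.

Lemma linfty_neq0 : exists phi : linfty, phi != 0.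
Proof.
exists weight_family; apply: (@family_neq0 _ t0).
by rewrite /= w_t0 oner_neq0.
Qed.

(** The base point t0, where the weight is 1, provides a nonzero vector and, in
    [shift_norm], the coordinate at which norms of powers are read off. *)
Definition linfty_op_algebra : banachAlgType R[i] := op_algebra linfty_neq0.

Section Op.
Variables (s : T -> T) (C : R).
Hypothesis C_ge0 : 0 <= C.
Hypothesis ws : forall t, w (s t) <= C * w t.

Lemma shift_bound (phi : linfty) t : nrm (phi (s t)) <= C * nrm phi * w t.
Proof.
by rewrite (le_trans (linftyP _ _))// mulrAC mulrC ler_wpM2r ?nrm_ge0.
Qed.

Lemma shift_subproof (phi : linfty) : (phi \o s) \in wpred all_families.
Proof.
apply: (@linfty_memP _ (C * nrm phi)); first by rewrite mulr_ge0 ?nrm_ge0.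
exact: shift_bound.
Qed.

Definition shift_fun (phi : linfty) : linfty := Wsup (shift_subproof phi).

Lemma shift_bounded_op : shift_fun \in wpred (operators linfty).
Proof.
apply: (@bounded_op_memP R linfty shift_fun C) => //.
- by move=> c phi psi; apply/val_inj/funext.
- move=> phi; apply: linfty_norm_le; first by rewrite mulr_ge0 ?nrm_ge0.
  exact: shift_bound.
Qed.

Definition shift_op : linfty_op_algebra :=
  (Wsup shift_bounded_op : bounded_op linfty).

Lemma shiftXE k (phi : linfty) t :
  ((shift_op ^+ k : bounded_op linfty) phi : linfty) t = phi (iter k s t).
Proof.
rewrite op_algebra_expE; elim: k t => // k ih t.
by rewrite iterS iterSr -ih.
Qed.

(** The upper bound is the weight inequality. For the lower bound, the k-th
    power of the shift sends the weight, of norm at most 1, to a family whose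
    value at t0 is w (s^k t0) = c. *)
Lemma shift_norm k c : 0 <= c -> (forall t, w (iter k s t) <= c * w t) ->
  w (iter k s t0) = c -> nrm (shift_op ^+ k) = c.
Proof.
move=> c0 hc wc; apply/eqP; rewrite eq_le; apply/andP; split.
  apply: bounded_op_norm_le => // phi; apply: linfty_norm_le.
    by rewrite mulr_ge0 ?nrm_ge0.
  move=> t; rewrite shiftXE (le_trans (linftyP _ _))//.
  by rewrite mulrAC mulrC ler_wpM2r ?nrm_ge0// mulrC.
have h := linftyP ((shift_op ^+ k : bounded_op linfty) weight_family) t0.
rewrite shiftXE /= wc w_t0 mulr1 in h.
rewrite -[nrm _]/(modulus _) modulus_real ger0_norm// in h.
rewrite (le_trans h)// (le_trans (bounded_opP _ _))//.
by rewrite ler_piMr ?nrm_ge0// weight_family_norm.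
Qed.

Lemma shift_eigen (phi : linfty) (lam : R[i]) : phi t0 != 0 ->
  (forall t, phi (s t) = lam * phi t) -> spectrum shift_op lam.
Proof.
move=> phi0 hphi; apply: (@eigenvector_spectrum _ _ _ _ _ phi).
  exact: (@family_neq0 _ t0).
by apply/val_inj/funext => t /=; rewrite hphi.
Qed.

End Op.

Lemma shiftK s C (C0 : 0 <= C) (ws : forall t, w (s t) <= C * w t)
  s' C' (C0' : 0 <= C') (ws' : forall t, w (s' t) <= C' * w t) :
  cancel s' s -> shift_op C0' ws' * shift_op C0 ws = 1.
Proof.
move=> ss; apply: bounded_op_ext => phi; apply/val_inj/funext => t /=.
by rewrite ss.
Qed.

End Shift.

(** * The ratio bounds of the sequence and the annulus K *)

Section InfRoot.
Variable R : realType.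

Lemma le_powR_root (x c : R) k : (0 < k)%N -> 0 <= x -> 0 <= c ->
  (x <= c `^ k%:R^-1) = (x ^+ k <= c).
Proof.
move=> k0 x0 c0; have kR : (k%:R : R) != 0 by rewrite pnatr_eq0 -lt0n.
have E : (c `^ k%:R^-1) ^+ k = c.
  by rewrite -powR_mulrn ?powR_ge0// -powRrM mulVf// powRr1.
by rewrite -[in RHS]E ler_pXn2r ?nnegrE ?powR_ge0.
Qed.

(** Comparison with the infimum of k-th roots amounts to comparison of all the
    k-th powers, which turns the description of K into inequalities between
    reals. *)
Lemma le_inf_root (x : R) (c : nat -> R) (u : nat -> \bar R) : 0 <= x ->
  (forall k, 0 <= c k) -> (forall k, u k = (c k)%:E) ->
  (x%:E <= inf_root u)%E <-> forall k, (0 < k)%N -> x ^+ k <= c k.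
Proof.
move=> x0 c0 uE; split=> [h k k0|h].
  rewrite -le_powR_root// -lee_fin (le_trans h)//.
  by apply: ereal_inf_lbound; exists k => //; rewrite uE poweR_EFin.
apply: le_ereal_inf_tmp => _ [k /= k0 <-].
by rewrite uE poweR_EFin lee_fin le_powR_root// h.
Qed.

End InfRoot.

Section RatioBound.
Variables (R : realType) (a : nat -> R).

(** The upper bounds c of C_i, with quotients cleared: in this form products
    of bounds are easy to form. *)
Definition ratio_bound (i : int) (c : R) : Prop :=
  forall m n : nat, n%:Z = m%:Z + i -> a n <= c * a m.

Lemma ratio_bound_opp k c :
  (forall m, a m <= c * a (m + k)%N) -> ratio_bound (- k%:Z) c.
Proof. by move=> h m n nm; have -> : m = (n + k)%N by lia. Qed.

Hypothesis a_gt0 : forall n, 0 < a n.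
Hypothesis a0 : a 0%N = 1.
Hypothesis aM : forall i j : nat, a (i + j)%N <= a i * a j.

Lemma C_leP i c : (C_ a i <= c%:E)%E <-> ratio_bound i c.
Proof.
split=> [h m n nm|h].
  rewrite -ler_pdivrMr// -lee_fin (le_trans _ h)//.
  by apply: ereal_sup_ubound; exists m, n.
apply: ge_ereal_sup => _ [m [n [nm ->]]].
by rewrite lee_fin ler_pdivrMr// h.
Qed.

Lemma C_gt0 i : (0 < C_ a i)%E.
Proof.
have [m [n nm]] : exists m n : nat, n%:Z = m%:Z + i.
  case: i => k; first by exists 0%N, k; rewrite add0r.
  by exists k.+1, 0%N; rewrite NegzE subrr.
apply: (@lt_le_trans _ _ (a n / a m)%:E); first by rewrite lte_fin divr_gt0.
by apply: ereal_sup_ubound; exists m, n.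
Qed.

(** By submultiplicativity the quotients a_(m+k) / a_m are at most a_k, which is
    the quotient for m = 0. *)
Lemma C_nonneg k : C_ a k%:Z = (a k)%:E.
Proof.
apply/eqP; rewrite eq_le; apply/andP; split.
  apply/C_leP => m n nm; have -> : n = (k + m)%N by lia.
  exact: aM.
by apply: ereal_sup_ubound; exists 0%N, k; rewrite add0r a0 divr1.
Qed.

(** Submultiplicativity of C. In going from m to m + i + j, at least one of the
    intermediate indices m + i and m + j is nonnegative, because m and
    m + i + j are; the bounds are chained through that one. *)
Lemma ratio_boundD i j c d : 0 <= c -> 0 <= d ->
  ratio_bound i c -> ratio_bound j d -> ratio_bound (i + j) (c * d).
Proof.
move=> c0 d0 ic jd m n nm.
have [mj|mj] := leP 0 (m%:Z + j).
  have pE : (absz (m%:Z + j)%R)%:Z = m%:Z + j by lia.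
  rewrite (le_trans (ic (absz (m%:Z + j)%R) n _))//; first by lia.
  by rewrite -mulrA ler_wpM2l// jd.
have pE : (absz (m%:Z + i)%R)%:Z = m%:Z + i by lia.
rewrite (le_trans (jd (absz (m%:Z + i)%R) n _))//; first by lia.
by rewrite [c * d]mulrC -mulrA ler_wpM2l// ic.
Qed.

Lemma ratio_boundX c k : 0 <= c -> ratio_bound (-1) c ->
  ratio_bound (- k%:Z) (c ^+ k).
Proof.
move=> c0 hc; elim: k => [|k ih].
  rewrite expr0 oppr0 => m n; rewrite addr0 => -[->].
  by rewrite mul1r.
rewrite exprS; have -> : - k.+1%:Z = -1 + - k%:Z by lia.
by apply: ratio_boundD => //; rewrite exprn_ge0.
Qed.

Lemma C_fin_bound : C_ a (-1) != +oo%E ->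
  exists2 c, 0 <= c & ratio_bound (-1) c.
Proof.
move=> ny; have := C_gt0 (-1); have := @C_leP (-1).
case: (C_ a (-1)) ny => // c _ h c0; exists c; first by rewrite ltW.
exact/h.
Qed.

Lemma K_discP lam : C_ a (-1) = +oo%E ->
  K_ a lam <-> forall k, (0 < k)%N -> modulus lam ^+ k <= a k.
Proof.
move=> h; rewrite /K_ h eqxx /=; apply: le_inf_root.
- exact: modulus_ge0.
- by move=> k; apply/ltW.
- exact: C_nonneg.
Qed.

Section Finite.
Hypothesis Cfin : C_ a (-1) != +oo%E.

(** When C_(-1) is finite, so is every C_i, being at most a_k or C_(-1)^k. *)
Definition C_fin (i : int) : R := fine (C_ a i).

Lemma C_finE i : C_ a i = (C_fin i)%:E.
Proof.
suff [c ic] : exists c, ratio_bound i c.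
  rewrite /C_fin fineK// fin_numE; have := C_gt0 i; move/C_leP : ic.
  by case: (C_ a i).
case: i => k; first by exists (a k); apply/C_leP; rewrite C_nonneg.
have [c c0 hc] := C_fin_bound Cfin.
by exists (c ^+ k.+1); rewrite NegzE; exact: ratio_boundX.
Qed.

Lemma C_fin_gt0 i : 0 < C_fin i.
Proof. by rewrite -lte_fin -C_finE C_gt0. Qed.

Lemma C_fin_nonneg k : C_fin k%:Z = a k.
Proof. by rewrite /C_fin C_nonneg. Qed.

Lemma C_finP i c : C_fin i <= c <-> ratio_bound i c.
Proof. by rewrite -C_leP C_finE lee_fin. Qed.

Lemma C_finD i j : C_fin (i + j) <= C_fin i * C_fin j.
Proof.
by apply/C_finP; apply: ratio_boundD; rewrite ?ltW ?C_fin_gt0//; exact/C_finP.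
Qed.

Lemma le_aX k : a k <= a 1%N ^+ k.
Proof.
elim: k => [|k ih]; first by rewrite expr0 a0.
by rewrite exprS (le_trans (aM 1 k))// ler_wpM2l// ltW.
Qed.

(** The infimum v of the roots of the C_(-k) is a positive real: it is at most
    C_(-1), and at least 1 / a_1 because 1 = C_0 <= C_(-k) C_k. So the
    inequality 1 / v <= |lam| means that lam is nonzero and 1 / |lam| <= v. *)
Lemma K_annulusP lam : K_ a lam <->
  [/\ lam != 0, forall k, (0 < k)%N -> modulus lam ^- k <= C_fin (- k%:Z) &
      forall k, (0 < k)%N -> modulus lam ^+ k <= a k].
Proof.
rewrite /K_ (negbTE Cfin) /=.
have up : ((modulus lam)%:E <= inf_root (fun k => C_ a k%:Z))%E <->
    forall k, (0 < k)%N -> modulus lam ^+ k <= a k.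
  apply: le_inf_root.
  - exact: modulus_ge0.
  - by move=> k; apply/ltW.
  - exact: C_nonneg.
set v := inf_root (fun k => C_ a (- k%:Z)).
have lo (x : R) : 0 <= x ->
    (x%:E <= v)%E <-> forall k, (0 < k)%N -> x ^+ k <= C_fin (- k%:Z).
  move=> x0; apply: le_inf_root => // k; first by rewrite ltW// C_fin_gt0.
  exact: C_finE.
have vlb : ((a 1%N)^-1%:E <= v)%E.
  apply/lo; first by rewrite invr_ge0 ltW.
  move=> k k0; rewrite exprVn -[leLHS]mul1r ler_pdivrMr ?exprn_gt0//.
  have := C_finD (- k%:Z) k%:Z; rewrite addNr (C_fin_nonneg 0) a0 => h.
  by rewrite (le_trans h)// C_fin_nonneg ler_wpM2l ?le_aX// ltW// C_fin_gt0.
have vub : (v <= (C_fin (-1) `^ 1%:R^-1)%:E)%E.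
  by apply: ereal_inf_lbound; exists 1%N => //; rewrite C_finE poweR_EFin.
have [r vE] : exists r, v = r%:E.
  by case: v vlb vub {lo} => // r _ _; exists r.
have r0 : 0 < r.
  by rewrite (lt_le_trans _ (_ : (a 1%N)^-1 <= r)) ?invr_gt0// -lee_fin -vE.
rewrite vE inver gt_eqF// lee_fin; split.
  move=> /andP[h1 /up h2].
  have lam0 : 0 < modulus lam by rewrite (lt_le_trans _ h1)// invr_gt0.
  split => //; first by rewrite -modulus_gt0.
  have /lo : ((modulus lam)^-1%:E <= v)%E.
    by rewrite vE lee_fin -[leRHS]invrK lef_pV2 ?posrE ?invr_gt0.
  rewrite invr_ge0 modulus_ge0 => /(_ isT) h k k0.
  by rewrite -exprVn h.
move=> [lam0 h1 /up ->]; rewrite andbT.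
rewrite -modulus_gt0 in lam0.
have /lo : forall k, (0 < k)%N -> (modulus lam)^-1 ^+ k <= C_fin (- k%:Z).
  by move=> k k0; rewrite exprVn h1.
rewrite invr_ge0 modulus_ge0 => /(_ isT); rewrite vE lee_fin => h.
by rewrite -[leRHS]invrK lef_pV2 ?posrE ?invr_gt0.
Qed.

End Finite.
End RatioBound.

(** * The shifts realizing the sequence, and the theorem *)

Section NatShift.
Variables (R : realType) (a : nat -> R).
Hypothesis a_ge0 : forall n, 0 <= a n.
Hypothesis a0 : a 0%N = 1.
Hypothesis aM : forall i j : nat, a (i + j)%N <= a i * a j.

Lemma iter_succ k n : iter k S n = (k + n)%N.
Proof. by elim: k => //= k ->. Qed.

Lemma nat_shift_weight n : a n.+1 <= a 1%N * a n.
Proof. exact: (aM 1). Qed.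

Definition nat_shift : linfty_op_algebra a_ge0 a0 :=
  shift_op a_ge0 a0 (a_ge0 1) nat_shift_weight.

Lemma nat_shift_norm k : nrm (nat_shift ^+ k) = a k.
Proof.
by apply: shift_norm => // [t|]; rewrite iter_succ ?addn0.
Qed.

(** The points of the disc are eigenvalues, with eigenvectors (lam^n)_n: the
    inequalities say precisely that this family is bounded by the weight a. *)
Lemma nat_shift_spectrum lam :
  spectrum nat_shift lam <-> forall k, (0 < k)%N -> modulus lam ^+ k <= a k.
Proof.
split=> [h k _|h].
  by rewrite -nat_shift_norm; exact: spectrum_modulus.
have mem : (fun n => lam ^+ n : cplx R) \in wpred (all_families a_ge0).
  apply: (@linfty_memP _ _ _ _ _ 1) => // n; rewrite mul1r.
  rewrite -[nrm _]/(modulus _) modulusX.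
  by case: n => [|n]; rewrite ?expr0 ?a0// h.
apply: (@shift_eigen _ _ _ _ _ _ _ _ _ _ (Wsup mem)) => /= [|n].
  by rewrite expr0 oner_neq0.
by rewrite exprS.
Qed.

End NatShift.

Section IntShift.
Variables (R : realType) (a : nat -> R).
Hypothesis a_gt0 : forall n, 0 < a n.
Hypothesis a0 : a 0%N = 1.
Hypothesis aM : forall i j : nat, a (i + j)%N <= a i * a j.
Hypothesis Cfin : C_ a (-1) != +oo%E.

Let c := C_fin a.

Lemma C_fin_ge0 i : 0 <= c i.
Proof. by rewrite /c ltW// C_fin_gt0. Qed.

Lemma C_fin0 : c 0 = 1.
Proof. by rewrite /c (C_fin_nonneg a_gt0 a0 aM 0). Qed.

Lemma int_shift_weight j i : c (i + j) <= c j * c i.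
Proof. by rewrite mulrC C_finD. Qed.

(** The weight is C itself, which is submultiplicative; the shift by j is then
    bounded by C_j, and shifts by opposite integers are inverse to each
    other. *)
Definition int_shift (j : int) : linfty_op_algebra C_fin_ge0 C_fin0 :=
  shift_op C_fin_ge0 C_fin0 (C_fin_ge0 j) (int_shift_weight j).

Lemma iter_addz (j : int) k i : iter k (fun i => i + j) i = i + j * k%:Z.
Proof. by elim: k => [|k ih]; rewrite ?mulr0 ?addr0//= ih; lia. Qed.

Lemma int_shift_norm j k : nrm (int_shift j ^+ k) = c (j * k%:Z).
Proof.
apply: shift_norm => [|t|]; rewrite ?iter_addz ?add0r ?C_fin_ge0//.
exact: int_shift_weight.
Qed.

Lemma int_shiftK j j' : j + j' = 0 -> int_shift j * int_shift j' = 1.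
Proof. by move=> jj; apply: shiftK => i; rewrite -addrA jj addr0. Qed.

(** The two halves of K bound the families (lam^i) for i >= 0 and i < 0, which
    makes its points eigenvalues. Conversely a point of the spectrum obeys the
    norm bounds of the powers of the shift, and its inverse those of the
    powers of the inverse shift. *)
Lemma int_shift_spectrum lam : spectrum (int_shift 1) lam <-> K_ a lam.
Proof.
have pos k : c (1 * k%:Z) = a k by rewrite mul1r /c C_fin_nonneg.
rewrite K_annulusP//; split => [h|[lam0 h1 h2]].
  have yz : int_shift 1 * int_shift (-1) = 1 by apply: int_shiftK.
  have zy : int_shift (-1) * int_shift 1 = 1 by apply: int_shiftK.
  have [lam0 hz] := spectrum_inverse yz zy h.
  split => // k k0.
    have := spectrum_modulus hz k.
    by rewrite int_shift_norm modulusV exprVn mulN1r.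
  by rewrite -pos -int_shift_norm; exact: spectrum_modulus.
have mem : (fun i : int => lam ^ i : cplx R) \in wpred (all_families C_fin_ge0).
  apply: (@linfty_memP _ _ _ _ _ 1) => // i; rewrite mul1r.
  rewrite -[nrm _]/(modulus _).
  case: i => [[|k]|k].
  - by rewrite expr0z modulus1 C_fin0.
  - by rewrite -exprnP modulusX /c C_fin_nonneg// h2.
  - by rewrite NegzE -exprnN modulusV modulusX h1.
apply: (@shift_eigen _ _ _ _ _ _ _ _ _ _ (Wsup mem)) => /= [|i].
  by rewrite expr0z oner_neq0.
by rewrite addrC expfzDr.
Qed.

End IntShift.

Theorem theorem2p13 (R : realType) (a : nat -> R)
    (a_ge0 : forall n, 0 <= a n) (a0 : a 0%N = 1)
    (aM : forall i j : nat, a (i + j)%N <= a i * a j) :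
  ((exists2 k : nat, (0 < k)%N & a k = 0) ->
     (forall (A : banachAlgType R[i]) (x : A),
        (forall n : nat, `|x ^+ n| = (a n)%:C) -> spectrum x = [set 0])
     /\ (exists (A : banachAlgType R[i]) (y : A),
           forall n : nat, `|y ^+ n| = (a n)%:C))
  /\
  ((forall n : nat, 0 < a n) ->
     (forall (A : banachAlgType R[i]) (x : A),
        (forall n : nat, `|x ^+ n| = (a n)%:C) ->
        exists2 B : set R[i], smallest_annulus (spectrum x) B & K_ a `<=` B)
     /\ (exists (A : banachAlgType R[i]) (y : A),
           (forall n : nat, `|y ^+ n| = (a n)%:C) /\ spectrum y = K_ a)).
Proof.
have realize : forall n, `|nat_shift a_ge0 a0 aM ^+ n| = (a n)%:C.
  by move=> n; rewrite nrmE nat_shift_norm.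
have nrmx (A : banachAlgType R[i]) (x : A) :
    (forall n : nat, `|x ^+ n| = (a n)%:C) -> forall n, nrm (x ^+ n) = a n.
  by move=> h n; apply: complexI; rewrite -nrmE.
split=> [[k k0 ak]|a_gt0]; (split=> [A x /nrmx hx|]).
- have sub mu : spectrum x mu -> mu = 0.
    move=> /spectrum_modulus /(_ k); rewrite hx ak => h.
    apply/eqP; apply: contraTT h => mu0.
    by rewrite -ltNge exprn_gt0// modulus_gt0.
  have [//||mu hmu _] := @spectrum_ge R A x 0.
    by move=> n; rewrite hx; case: n => [|n]; rewrite ?expr0 ?a0// expr0n.
  apply/seteqP; split=> [nu /sub//|_ ->].
  by rewrite -(sub _ hmu).
- by exists (linfty_op_algebra a_ge0 a0), (nat_shift a_ge0 a0 aM).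
- have [r1 [r2 [h12 hr2 hr1]]] := smallest_annulus_spectrum x.
  exists (annulus r1 r2) => // lam Klam.
  have Kup k : (0 < k)%N -> modulus lam ^+ k <= a k.
    have [Cinf|Cfin] := eqVneq (C_ a (-1)) +oo%E.
      by move/(K_discP a_gt0 a0 aM _ Cinf) : Klam; exact.
    by move/(K_annulusP a_gt0 a0 aM Cfin) : Klam => [_ _]; exact.
  apply/andP; split; last first.
    apply: hr2; first exact: modulus_ge0.
    by move=> [|k]; rewrite hx ?expr0 ?a0// Kup.
  (* the inner radius: either 0 is in the spectrum, or x has an inverse z, whose
     powers bound the ratios a_m / a_(m+k) because x^m = z^k x^(m+k) *)
  have [[z [zx xz]]|/spectrum0 x0] := pselect (invertible x); last first.
    by rewrite (le_trans (hr1 _ x0))// modulus0 modulus_ge0.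
  have bound k : ratio_bound a (- k%:Z) (nrm (z ^+ k)).
    apply: ratio_bound_opp => m; rewrite -!hx.
    have -> : x ^+ m = z ^+ k * x ^+ (m + k).
      rewrite addnC exprD mulrA -exprMn_comm ?zx ?expr1n ?mul1r//.
      by rewrite /GRing.comm zx xz.
    exact: nrmM.
  have Cfin : C_ a (-1) != +oo%E.
    have /(C_leP a_gt0) := bound 1%N.
    by case: (C_ a _).
  move/(K_annulusP a_gt0 a0 aM Cfin) : Klam => [lam0 Klow _].
  have [||mu hmu mule] := @spectrum_ge R A z (modulus lam)^-1.
  - by rewrite invr_ge0 modulus_ge0.
  - move=> [|k]; first by rewrite !expr0 nrm1.
    rewrite exprVn (le_trans (Klow _ _))//.
    exact/(C_finP a_gt0 a0 aM Cfin)/bound.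
  have [mu0 hmuV] := spectrum_inverse zx xz hmu.
  rewrite (le_trans (hr1 _ hmuV))// modulusV -[leRHS]invrK.
  by rewrite lef_pV2 ?posrE ?invr_gt0 ?modulus_gt0.
- have [Cinf|Cfin] := eqVneq (C_ a (-1)) +oo%E.
    exists (linfty_op_algebra a_ge0 a0), (nat_shift a_ge0 a0 aM); split => //.
    apply/seteqP; split=> lam.
      by move/nat_shift_spectrum => h; apply/K_discP.
    by move/K_discP => h; apply/nat_shift_spectrum; exact: h.
  exists (linfty_op_algebra (C_fin_ge0 a_gt0 a0 aM Cfin) (C_fin0 a_gt0 a0 aM)).
  exists (int_shift a_gt0 a0 aM Cfin 1); split.
    by move=> n; rewrite nrmE int_shift_norm mul1r C_fin_nonneg.
  by apply/seteqP; split=> lam /int_shift_spectrum.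
Qed.
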